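(* Let $f:\mathbb{R}^d\to\mathbb{R}^d$ be an order-preserving nonexpansive map whose coordinates are given by $f_j(x)=\inf_{a\in A_j}f^{a}(x)$, $1\leqslant j\leqslant d$, where each $A_j$ is a finite nonempty set and each $f^a:\mathbb{R}^d\to\mathbb{R}$ is a supremum of finitely many order-preserving nonexpansive affine maps. If for every strategy $\pi$ the map $f^\pi$ has a smallest fixed point in $\mathbb{R}^d$, then the policy iteration algorithm described in the context terminates (i.e. every run of it stops after finitely many steps).
   Context: $\mathbb{R}^d$ carries the sup-norm $\|\cdot\|$ and the coordinatewise partial order $\leqslant$; $x<y$ means $x\leqslant y$ and $x\neq y$; $\mathbb{R}^d_-=\{h\mid h\leqslant 0\}$. Order-preserving: $x\leqslant y$ implies $f(x)\leqslant f(y)$. Nonexpansive: $\|f(x)-f(y)\|\leqslant\|x-y\|$ (with absolute value on the left for real-valued maps). The smallest fixed point of a map is a fixed point $u\in\mathbb{R}^d$ with $u\leqslant v$ for every fixed point $v\in\mathbb{R}^d$. A strategy $\pi$ is a map from $\{1,\dots,d\}$ to $\bigcup_{j}A_j$ with $\pi(j)\in A_j$ for all $j$; the associated map is $f^\pi=(f^{\pi(1)},\dots,f^{\pi(d)}):\mathbb{R}^d\to\mathbb{R}^d$. Semidifferential: a map $F$ (into $\mathbb{R}^d$ or $\mathbb{R}$) is semidifferentiable at $u$ if there is a continuous map $g$, homogeneous in the sense that $g(\lambda h)=\lambda g(h)$ for $\lambda>0$, with $F(u+h)=F(u)+g(h)+o(\|h\|)$ near $h=0$; then $g$ is unique and denoted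 $F'_u$. Under the assumptions here $f$ and all $f^a$ are piecewise affine, hence semidifferentiable everywhere. Spectral radius: $\rho(f'_u)=\sup\{\lambda\geqslant 0\mid\exists x\in\mathbb{R}^d_-\setminus\{0\},\ f'_u(x)=\lambda x\}$, which is at most $1$ here because $f$ is nonexpansive. The policy iteration algorithm: - Init: select an arbitrary strategy $\pi^0$ and set $k=0$. - Step $(D_k)$ (value determination): compute (by an oracle) the smallest fixed point $u^k\in\mathbb{R}^d$ of $f^{\pi^k}$. - Step $(I^1_k)$ (policy improvement): if $f(u^k)<u^k$, take a strategy $\pi^{k+1}$ such that $f(u^k)=f^{\pi^{k+1}}(u^k)$ and go to step $(D_{k+1})$. - Step $(I^2_k)$ (policy improvement): if $f(u^k)=u^k$, compute (by an oracle) $\alpha_k=\rho(f'_{u^k})$. If $\alpha_k<1$, stop and return $u^k$. If $\alpha_k=1$, take (by an oracle) $h\in\mathbb{R}^d_-\setminus\{0\}$ with $f'_{u^k}(h)=h$; for each $j$ let $\overline{A_j}=\{a\in A_j\mid f^a(u^k)=f_j(u^k)\}$ and let $\pi^{k+1}(j)$ be an action $a\in\overline{A_j}$ attaining the minimum in $(f'_{u^k})_j(h)=\min_{a\in\overline{A_j}}(f^a)'_{u^k}(h)$; go to step $(D_{k+1})$. *)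

(* Defs.v *)
From HB Require Import structures.
From mathcomp Require Import all_boot all_order all_algebra.
From mathcomp Require Import all_classical all_reals all_analysis.

Set Implicit Arguments.
Unset Strict Implicit.
Unset Printing Implicit Defensive.

Import Order.TTheory GRing.Theory Num.Theory.
Import numFieldNormedType.Exports.

Local Open Scope classical_set_scope.
Local Open Scope ring_scope.

(* Vectors of R^d are row vectors; the library norm on 'rV[R]_d is the
   sup-norm. *)

Section Order.
Context {R : realType} {d : nat}.
Implicit Types x y : 'rV[R]_d.

Definition vle x y : Prop := forall j, x 0 j <= y 0 j.

Definition vlt x y : Prop := vle x y /\ x <> y.

Definition order_preserving (f : 'rV[R]_d -> 'rV[R]_d) : Prop :=
  forall x y, vle x y -> vle (f x) (f y).

Definition order_preserving_scalar (g : 'rV[R]_d -> R) : Prop :=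
  forall x y, vle x y -> g x <= g y.

Definition smallest_fixed_point (f : 'rV[R]_d -> 'rV[R]_d) (u : 'rV[R]_d) :
    Prop :=
  f u = u /\ forall v, f v = v -> vle u v.

End Order.

Definition nonexpansive {R : realType} {V W : normedModType R} (f : V -> W) :
    Prop :=
  forall x y, `|f x - f y| <= `|x - y|.

Definition affine {R : realType} {d : nat} (g : 'rV[R]_d -> R) : Prop :=
  exists (l : {linear 'rV[R]_d -> R^o}) (b : R), forall x, g x = l x + b.

Definition finite_sup_affine {R : realType} {d : nat} (g : 'rV[R]_d -> R) :
    Prop :=
  exists P : set ('rV[R]_d -> R),
    [/\ finite_set P,
        P !=set0,
        (forall p, P p ->
           [/\ affine p, order_preserving_scalar p & nonexpansive p])
      & forall x, g x = sup [set p x | p in P]].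

Section Semidifferential.
Context {R : realType} {V W : normedModType R}.

Definition is_semidifferential (F : V -> W) (u : V) (g : V -> W) : Prop :=
  [/\ continuous g,
      (forall (lambda : R) (h : V), 0 < lambda ->
         g (lambda *: h) = lambda *: g h)
    & (fun h => F (u + h) - (F u + g h)) =o_ (0 : V) (@id V)].

(* A semidifferential is unique when it exists; the value is 0 when F is not
   semidifferentiable at u. *)
Definition semidifferential (F : V -> W) (u : V) : V -> W :=
  xget (fun=> 0) [set g | is_semidifferential F u g].

End Semidifferential.

(* The supremum is taken in R; [sup] of the empty set is 0. *)
Definition spectral_radius {R : realType} {d : nat}
    (g : 'rV[R]_d -> 'rV[R]_d) : R :=
  sup [set lambda : R | 0 <= lambda /\
    exists x : 'rV[R]_d, [/\ vle x 0, x <> 0 & g x = lambda *: x]].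

Section PolicyIteration.
Context {R : realType} {d : nat} {T : Type}.
Variables (A : 'I_d -> set T) (fa : T -> 'rV[R]_d -> R).
Variable f : 'rV[R]_d -> 'rV[R]_d.
Implicit Types u : 'rV[R]_d.

Definition strategy (pi : 'I_d -> T) : Prop := forall j, A j (pi j).

Definition strategy_map (pi : 'I_d -> T) : 'rV[R]_d -> 'rV[R]_d :=
  fun x => \row_j fa (pi j) x.

Definition active_actions u (j : 'I_d) : set T :=
  [set a | A j a /\ fa a u = f u 0 j].

Definition improvement1 u (pi' : 'I_d -> T) : Prop :=
  [/\ vlt (f u) u, strategy pi' & f u = strategy_map pi' u].

Definition improvement2 u (pi' : 'I_d -> T) : Prop :=
  [/\ f u = u,
      spectral_radius (semidifferential f u) = 1
    & exists h : 'rV[R]_d,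
        [/\ vle h 0, h <> 0, semidifferential f u h = h
          & forall j, active_actions u j (pi' j) /\
              forall a, active_actions u j a ->
                (semidifferential (fa (pi' j)) u h : R)
                  <= semidifferential (fa a) u h]].

Definition improvement u (pi' : 'I_d -> T) : Prop :=
  improvement1 u pi' \/ improvement2 u pi'.

Definition stops u : Prop :=
  f u = u /\ spectral_radius (semidifferential f u) < 1.

(* The algorithm performs the value determinations D_0, ..., D_n, producing
   u 0, ..., u n from pi 0, ..., pi n; later terms are irrelevant.  Any answer
   of the oracles is allowed, and [improvement] is incompatible with
   [stops]. *)
Definition run_upto (n : nat) (pi : nat -> 'I_d -> T)
    (u : nat -> 'rV[R]_d) : Prop :=
  [/\ strategy (pi 0%N),
      (forall k, (k <= n)%N -> smallest_fixed_point (strategy_map (pi k)) (u k))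
    & forall k, (k < n)%N -> improvement (u k) (pi k.+1)].

Definition infinite_run (pi : nat -> 'I_d -> T) (u : nat -> 'rV[R]_d) : Prop :=
  forall n, run_upto n pi u.

(* Every run stops after finitely many steps: no run is infinite, and a finite
   run that has not reached the stopping test can always be continued, so it
   cannot get stuck (the next value determination is possible as soon as
   the map of each strategy has a smallest fixed point). *)
Definition policy_iteration_terminates : Prop :=
  (forall pi (u : nat -> 'rV[R]_d), ~ infinite_run pi u) /\
  (forall n pi (u : nat -> 'rV[R]_d), run_upto n pi u ->
     stops (u n) \/ exists pi', improvement (u n) pi').

End PolicyIteration.

(* Main.v *)
(** A finite minimum of finite maxima of affine maps is affine on each short
    segment issued from a given point [u], uniformly in the direction; being
    nonexpansive, it is therefore semidifferentiable at [u], and coincides near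
    [u] with its first-order expansion.

    The values [u k] strictly decrease.  If [f (u k) < u k], the new strategy map
    [g] satisfies [g (u k) <= u k], and Knaster-Tarski gives it a fixed point
    below [u k].  If [f (u k) = u k] and [h] is a fixed direction, then
    [u k + t *: h] is a fixed point of the new strategy map for small [t > 0].
    As [u k] is determined by the [k]-th strategy, no strategy occurs twice, and
    there are finitely many of them.  A run is never stuck because the supremum
    defining a spectral radius equal to 1 is attained, by compactness. *)
Require Import Defs.
From mathcomp Require Import all_boot all_order all_algebra.
From mathcomp Require Import all_classical all_reals all_analysis.
From mathcomp Require Import lra.
Set Implicit Arguments.
Unset Strict Implicit.
Unset Printing Implicit Defensive.

Import Order.TTheory GRing.Theory Num.Theory.
Import numFieldNormedType.Exports.
Local Open Scope classical_set_scope.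
Local Open Scope ring_scope.

(** * Minimizers and common radii over finite sets *)

Lemma finite_argmin {R : realType} {I : Type} (D : set I) :
  finite_set D -> D !=set0 -> forall phi : I -> R,
  exists2 i, D i & forall k, D k -> phi i <= phi k.
Proof.
move=> finD [i0 Di0] phi; have /finite_seqP[s Ds] := finite_image phi finD.
have min_s (r : seq R) : r != [::] ->
    exists2 m, m \in r & forall x, x \in r -> m <= x.
  elim: r => // x r IH _; have [->|/IH[m mr mP]] := eqVneq r [::].
    by exists x; rewrite ?mem_head// => y; rewrite inE => /eqP->.
  have [xm|/ltW mx] := leP x m.
    exists x; rewrite ?mem_head// => y; rewrite inE => /predU1P[->//|/mP].
    exact: le_trans.
  exists m => [|y]; first by rewrite inE mr orbT.
  by rewrite inE => /predU1P[->//|/mP].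
have inS i : D i -> phi i \in s.
  by move=> Di; have : (phi @` D) (phi i); [exists i|rewrite Ds].
have [|m ms mP] := min_s s; first by case: s {Ds min_s} inS => // /(_ _ Di0).
have : (phi @` D) m by rewrite Ds.
by case=> i Di im; exists i => // k /inS; rewrite im; exact: mP.
Qed.

(** The smallest of the chosen radii serves every index, since [P] is inherited by smaller radii.
    All finite intersections of neighbourhoods below go through this lemma. *)
Lemma finite_common_radius {R : realType} {I : Type} (D : set I)
    (P : I -> R -> Prop) :
  finite_set D ->
  (forall i e e', P i e -> 0 < e' -> e' <= e -> P i e') ->
  (forall i, D i -> exists2 e, 0 < e & P i e) ->
  exists2 e, 0 < e & forall i, D i -> P i e.
Proof.
move=> finD mono ex.
have [D0|/nonemptyPn D0] := pselect (D !=set0); last first.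
  by exists 1 => // i; rewrite D0.
pose r i := xget 1 [set e | 0 < e /\ P i e].
have rP i : D i -> 0 < r i /\ P i (r i).
  by move=> /ex[e e0 Pe]; apply: (@xgetPex _ 1 [set e | 0 < e /\ P i e]); exists e.
have [i Di imin] := finite_argmin finD D0 r.
exists (r i); first by case: (rP i Di).
by move=> k Dk; apply: (mono k (r k)); [case: (rP k Dk)|case: (rP i Di)|exact: imin].
Qed.

(** * Pointwise minima of finite families *)

Definition is_min_of {R : realType} {V I : Type} (D : set I)
    (phi : I -> V -> R) (m : V -> R) : Prop :=
  forall x, (exists2 i, D i & m x = phi i x) /\
            (forall i, D i -> m x <= phi i x).

Lemma inf_is_min_of {R : realType} {V I : Type} (D : set I)
    (phi : I -> V -> R) (m : V -> R) :
  finite_set D -> D !=set0 ->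
  (forall x, m x = inf [set phi i x | i in D]) -> is_min_of D phi m.
Proof.
move=> finD D0 mE x.
have [i Di imin] := finite_argmin finD D0 (phi ^~ x).
have -> : m x = phi i x.
  rewrite mE; apply/eqP; rewrite eq_le; apply/andP; split.
    by apply: ge_inf; [exists (phi i x) => _ [k Dk <-]; exact: imin|exists i].
  by apply: lb_le_inf => [|_ [k Dk <-]]; [exists (phi i x), i|exact: imin].
by split=> //; exists i.
Qed.

(** Turns maxima into minima of opposites, so that each fact about minima serves for both. *)
Lemma sup_is_min_of_opp {R : realType} {V I : Type} (D : set I)
    (phi : I -> V -> R) (m : V -> R) :
  finite_set D -> D !=set0 ->
  (forall x, m x = sup [set phi i x | i in D]) ->
  is_min_of D (fun i => - phi i) (- m).
Proof.
move=> finD D0 mE; apply: inf_is_min_of => // x.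
rewrite fctE /= mE /inf; congr (- sup _).
apply/seteqP; split => [_ [i Di <-]|_ [_ [i Di <-] <-]].
  by exists (- phi i x); [exists i|rewrite opprK].
by exists i => //; rewrite opprK.
Qed.

Lemma nonexpansive_continuous {R : realType} {V W : normedModType R}
  (F : V -> W) : nonexpansive F -> continuous F.
Proof.
move=> neF x; apply/cvgrPdist_lt => e e0.
apply/nbhs_ballP; exists e => //= y; rewrite -ball_normE /=.
by apply: le_lt_trans; exact: neF.
Qed.

Lemma nonexpansive_opp {R : realType} {V : normedModType R} (F : V -> R) :
  nonexpansive F -> nonexpansive (- F).
Proof. by move=> neF x y; rewrite -opprD normrN; exact: neF. Qed.

Section Minimum.
Context {R : realType} {V : normedModType R} {I : Type}.
Variables (D : set I) (phi : I -> V -> R) (m : V -> R).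
Hypothesis mP : is_min_of D phi m.
Hypothesis phi_ne : forall i, D i -> nonexpansive (phi i).

Lemma min_nonexpansive : nonexpansive m.
Proof.
have half x y : m x - m y <= `|x - y|.
  (* The member attaining the minimum at [y] bounds [m x] from above. *)
  have [[i Di ->] _] := mP y; have [_ /(_ i Di) mx] := mP x.
  apply: le_trans (phi_ne Di x y); apply: le_trans (ler_norm _).
  by rewrite lerB.
by move=> x y; rewrite ler_norml lerNl opprB half distrC half.
Qed.

(** A member inactive at [u] lies above [m] by a positive gap there. Both functions move by at most
    [|h|], so the member stays strictly above [m] while [|h|] is less than half the gap. *)
Lemma min_active (u : V) : finite_set D ->
  exists2 e, 0 < e & forall i h, D i -> `|h| < e ->
    m (u + h) = phi i (u + h) -> phi i u = m u.
Proof.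
move=> finD.
have [e e0 eP] : exists2 e, 0 < e & forall i, D i -> forall h, `|h| < e ->
    m (u + h) = phi i (u + h) -> phi i u = m u.
  apply: (finite_common_radius (P := fun i e => forall h, `|h| < e ->
    m (u + h) = phi i (u + h) -> phi i u = m u)) => //.
    by move=> i e e' iP _ e'e h he'; apply: iP; exact: lt_le_trans e'e.
  move=> i Di.
  have [->|ne] := eqVneq (phi i u) (m u); first by exists 1.
  have [_ /(_ i Di)] := mP u; rewrite le_eqVlt eq_sym (negPf ne)/= => gap.
  exists ((phi i u - m u) / 2); first by rewrite divr_gt0// subr_gt0.
  move=> h hlt mh.
  have /ler_normlP[_] := phi_ne Di u (u + h).
  have /ler_normlP[_] := min_nonexpansive (u + h) u.
  by rewrite [u + h - u]addrC addKr opprD addNKr normrN mh; lra.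
by exists e => // i h /eP; exact.
Qed.
End Minimum.

(** * Maps that are conical near a point *)

(* Near [u], [F] is [F u] plus a positively homogeneous map.  Stated without
   naming that map, the property passes to finite minima without any formula for
   the semidifferential. *)
Definition conical_at {R : realType} {V W : normedModType R} (F : V -> W)
    (u : V) : Prop :=
  exists2 e : R, 0 < e & forall (h : V) (t : R), `|h| < e -> 0 < t -> t <= 1 ->
    F (u + t *: h) - F u = t *: (F (u + h) - F u).

Lemma conical_at_opp {R : realType} {V : normedModType R} (F : V -> R) u :
  conical_at (- F) u -> conical_at F u.
Proof.
move=> [e e0 eP]; exists e => // h t he t0 t1.
have := eP h t he t0 t1; rewrite !fctE /= /GRing.scale /=; lra.
Qed.

(** For one inequality, follow the member attaining the minimum at [u + h]; for the other, the
    member attaining it at [u + t *: h]. By [min_active] both are active at [u], so their increments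
    compare with those of [m]. *)
Lemma conical_at_min {R : realType} {V : normedModType R} {I : Type}
    (D : set I) (phi : I -> V -> R) (m : V -> R) (u : V) :
  finite_set D -> is_min_of D phi m ->
  (forall i, D i -> nonexpansive (phi i)) ->
  (forall i, D i -> conical_at (phi i) u) -> conical_at m u.
Proof.
move=> finD mP ne con.
have [r r0 rP] := min_active mP ne u finD.
have [|e e0 eP] := finite_common_radius finD _ con.
  by move=> i e e' H _ e'e h t he'; apply: H; exact: lt_le_trans e'e.
exists (Num.min r e) => [|h t]; first by rewrite lt_min r0.
rewrite lt_min => /andP[hr he] t0 t1.
have thr : `|t *: h| < r.
  rewrite normrZ gtr0_norm//; apply: le_lt_trans hr.
  by rewrite ler_piMl.
apply/eqP; rewrite eq_le; apply/andP; split.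
- have [[i Di mi] _] := mP (u + h); have iu := rP i h Di hr mi.
  rewrite mi -iu -(eP i Di h t he t0 t1) lerB//.
  by have [_] := mP (u + t *: h); exact.
- have [[i Di mi] _] := mP (u + t *: h); have iu := rP i _ Di thr mi.
  rewrite mi -iu (eP i Di h t he t0 t1) /GRing.scale /= ler_pM2l// lerB//.
  by have [_] := mP (u + h); exact.
Qed.

Lemma conical_at_coord {R : realType} {V : normedModType R} {d : nat}
    (F : V -> 'rV[R]_d) u :
  (forall j, conical_at (fun x => F x 0 j) u) -> conical_at F u.
Proof.
move=> con.
have [e e0 eP] : exists2 e, 0 < e & forall j, [set: 'I_d] j ->
    forall (h : V) t, `|h| < e -> 0 < t -> t <= 1 ->
      F (u + t *: h) 0 j - F u 0 j = t * (F (u + h) 0 j - F u 0 j).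
  apply: finite_common_radius => [|i e e' H _ e'e h t he'|j _]; last exact: con.
    exact: finite_finset.
  by apply: H; exact: lt_le_trans e'e.
exists e => // h t he t0 t1; apply/rowP => j; rewrite !mxE.
exact: eP.
Qed.

Lemma conical_at_affine {R : realType} {d : nat} (p : 'rV[R]_d -> R) u :
  affine p -> conical_at p u.
Proof.
move=> [l [b pE]]; exists 1 => // h t _ _ _.
rewrite !pE !linearD linearZ /GRing.scale /=; lra.
Qed.

Lemma finite_sup_affine_nonexpansive {R : realType} {d : nat}
  (p : 'rV[R]_d -> R) : finite_sup_affine p -> nonexpansive p.
Proof.
move=> [P [finP P0 PP pE]]; rewrite -[p]opprK; apply: nonexpansive_opp.
apply: (min_nonexpansive (sup_is_min_of_opp finP P0 pE)) => q /PP[_ _ neq].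
exact: nonexpansive_opp.
Qed.

Lemma finite_sup_affine_conical {R : realType} {d : nat}
  (p : 'rV[R]_d -> R) u : finite_sup_affine p -> conical_at p u.
Proof.
move=> [P [finP P0 PP pE]]; apply: conical_at_opp.
apply: (conical_at_min finP (sup_is_min_of_opp finP P0 pE)) => q /PP[aq _ neq].
  exact: nonexpansive_opp.
apply: conical_at_opp; rewrite opprK; exact: conical_at_affine.
Qed.

(** * Semidifferentials of conical maps *)

Section Conical.
Context {R : realType} {V W : normedModType R}.
Variables (F : V -> W) (u : V).

Lemma small_scaling (h : V) (e : R) : 0 < e ->
  exists t : R, [/\ 0 < t, t <= 1 & `|t *: h| < e].
Proof.
move=> e0; have h1 : 0 < 1 + `|h| by rewrite ltr_pwDl.
have q0 : 0 < e / (1 + `|h|) by rewrite divr_gt0.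
(* Adding 1 to the norm keeps the denominator positive when [h = 0]. *)
exists (Num.min 1 (e / (1 + `|h|))); split.
- by rewrite lt_min ltr01.
- by rewrite ge_min lexx.
- rewrite normrZ gtr0_norm ?lt_min ?ltr01//.
  apply: (@le_lt_trans _ _ (e / (1 + `|h|) * `|h|)).
    by rewrite ler_wpM2r// ge_min lexx orbT.
  by rewrite -mulrA gtr_pMr// ltr_pdivrMl// mulr1 ltrDr.
Qed.

(** A first-order expansion with no remainder near [u]; this exactness is what later yields true
    fixed points on a segment. *)
Definition locally_equal_to (g : V -> W) : Prop :=
  (forall (a : R) h, 0 < a -> g (a *: h) = a *: g h) /\
  exists2 e : R, 0 < e & forall h, `|h| < e -> F (u + h) = F u + g h.

(** The difference quotient of [F] along [h] is the same at all sufficiently small scales, so any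
    such scale defines [g h]. Homogeneity is then a change of scale. *)
Lemma conical_at_locally_equal : conical_at F u ->
  exists g, locally_equal_to g.
Proof.
move=> [e e0 eP].
have [s sP] := choice (fun h => small_scaling h e0).
have key h (t1 t2 : R) : 0 < t1 -> t1 <= t2 -> `|t2 *: h| < e ->
    t1^-1 *: (F (u + t1 *: h) - F u) = t2^-1 *: (F (u + t2 *: h) - F u).
  move=> t10 t12 he; have t20 := lt_le_trans t10 t12.
  have -> : t1 *: h = (t1 / t2) *: (t2 *: h).
    by rewrite scalerA mulfVK ?gt_eqF.
  rewrite eP ?divr_gt0// ?ler_pdivrMr ?mul1r//.
  by rewrite scalerA mulrA mulVf ?gt_eqF// mul1r.
pose g h := (s h)^-1 *: (F (u + s h *: h) - F u).
have gE h t : 0 < t -> `|t *: h| < e -> g h = t^-1 *: (F (u + t *: h) - F u).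
  move=> t0 he; have [s0 _ she] := sP h.
  by have [st|/ltW ts] := leP (s h) t; [exact: key|symmetry; exact: key].
exists g; split => [a h a0|].
  have [t [t0 _ the]] := small_scaling (a *: h) e0.
  have the' : `|(t * a) *: h| < e by rewrite -scalerA.
  rewrite (gE _ t)// (gE _ (t * a)) ?mulr_gt0// [RHS]scalerA [t *: _]scalerA.
  by rewrite invfM mulrCA mulfV ?gt_eqF// mulr1.
by exists e => // h he; rewrite (gE h 1)// ?scale1r// invr1 scale1r subrKC.
Qed.

(** Shrink both vectors by a common factor [t] into the ball where the expansion is exact, then
    divide by [t]. This gives the continuity of [g] and, later, the bound 1 on the spectral
    radius. *)
Lemma locally_equal_nonexpansive g :
  nonexpansive F -> locally_equal_to g -> nonexpansive g.
Proof.
move=> neF [hom [e e0 eP]] x y.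
have [t1 [t10 _ xe]] := small_scaling x e0.
have [t2 [t20 _ ye]] := small_scaling y e0.
pose t := Num.min t1 t2.
have t0 : 0 < t by rewrite lt_min t10.
have txe : `|t *: x| < e.
  apply: le_lt_trans xe; rewrite !normrZ ler_wpM2r// !gtr0_norm//.
  by rewrite ge_min lexx.
have tye : `|t *: y| < e.
  apply: le_lt_trans ye; rewrite !normrZ ler_wpM2r// !gtr0_norm//.
  by rewrite ge_min lexx orbT.
have := neF (u + t *: x) (u + t *: y).
rewrite !eP// !hom//; do 2!rewrite opprD addrACA subrr add0r.
rewrite -!scalerBr !normrZ.
by rewrite ler_pM2l// normr_gt0 gt_eqF.
Qed.

Lemma locally_equal_is_semidifferential g :
  nonexpansive F -> locally_equal_to g -> is_semidifferential F u g.
Proof.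
move=> neF lg; split.
- exact/nonexpansive_continuous/locally_equal_nonexpansive.
- by case: lg.
- have [_ [e e0 eP]] := lg; apply/eqoP => r r0.
  apply/nbhs_ballP; exists e => //= h; rewrite -ball_normE /= sub0r normrN => he.
  by rewrite eP// subrr normr0 mulr_ge0// ltW.
Qed.

Lemma semidifferential_unique g1 g2 :
  is_semidifferential F u g1 -> is_semidifferential F u g2 -> g1 = g2.
Proof.
move=> [_ hom1 /eqoP o1] [_ hom2 /eqoP o2]; apply/funext => h.
apply/eqP; rewrite -subr_eq0 -normr_le0; apply/ler_addgt0Pr => r r0.
rewrite add0r.
have h1 : 0 < 1 + `|h| by rewrite ltr_pwDl.
(* Chosen so that the two error terms, once divided by [t], add up to at most [r]. *)
pose q := r / (1 + `|h|) / 2.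
have q0 : 0 < q by rewrite !divr_gt0.
have /nbhs_ballP[e /= e0 eP] : \forall k \near (0 : V),
    `|F (u + k) - (F u + g1 k)| <= q * `|k| /\
    `|F (u + k) - (F u + g2 k)| <= q * `|k|.
  by apply: filterI; [exact: o1|exact: o2].
have [t [t0 _ the]] := small_scaling h e0.
have /eP[] : ball (0 : V) e (t *: h) by rewrite -ball_normE /= sub0r normrN.
rewrite hom1// hom2// => l1 l2.
have : `|t *: (g1 h - g2 h)| <= q * `|t *: h| + q * `|t *: h|.
  apply: le_trans (lerD l2 l1); apply: le_trans (ler_normB _ _).
  by rewrite opprB [X in _ <= `|X|]addrC subrKA opprD addrACA subrr add0r scalerBr.
rewrite !normrZ gtr0_norm// -mulrDl mulrCA ler_pM2l// => /le_trans; apply.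
rewrite /q -splitr -mulrA ger_pMr// ler_pdivrMl// mulr1.
by rewrite lerDr.
Qed.

(** Uniqueness identifies the value chosen by [xget] with the exact local expansion. *)
Lemma semidifferentialP : nonexpansive F -> conical_at F u ->
  locally_equal_to (semidifferential F u).
Proof.
move=> neF /conical_at_locally_equal[g lg].
have sg := locally_equal_is_semidifferential neF lg.
suff -> : semidifferential F u = g by [].
apply: semidifferential_unique (sg).
by apply: (@xgetPex _ _ [set g | is_semidifferential F u g]); exists g.
Qed.

End Conical.

(** * Order, sup-norm and fixed points of row vectors *)

Section Rows.
Context {R : realType} {d : nat}.
Implicit Types x y u v : 'rV[R]_d.

Lemma coord_norm_le x j : `|x 0 j| <= `|x|.
Proof.
rewrite [leRHS]mx_normrE.
exact: (le_bigmax _ (fun ij : 'I_1 * 'I_d => `|x ij.1 ij.2|) (0, j)).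
Qed.

Lemma row_norm_le x (r : R) : 0 <= r -> (forall j, `|x 0 j| <= r) -> `|x| <= r.
Proof.
move=> r0 xr; rewrite [leLHS]mx_normrE; apply: bigmax_le => // -[i j] _ /=.
by rewrite ord1.
Qed.

Lemma vle_trans y x z : vle x y -> vle y z -> vle x z.
Proof. by move=> xy yz j; exact: le_trans (xy j) (yz j). Qed.

Lemma vle_anti x y : vle x y -> vle y x -> x = y.
Proof. by move=> xy yx; apply/rowP => j; apply/le_anti; rewrite xy yx. Qed.

Lemma vlt_trans y x z : vlt x y -> vlt y z -> vlt x z.
Proof.
move=> [xy nxy] [yz nyz]; split; first exact: vle_trans yz.
by move=> xz; apply: nxy; apply: vle_anti xy _; rewrite xz.
Qed.

(* Knaster-Tarski on the points of the ball around [v] of radius [`|u - v|]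
   lying below [u]: the map [g] preserves this ball because it fixes [v]. *)
Lemma fixed_point_below (g : 'rV[R]_d -> 'rV[R]_d) u v :
  order_preserving g -> nonexpansive g -> g v = v -> vle (g u) u ->
  exists w, g w = w /\ vle w u.
Proof.
move=> mono ne gv gu; pose r := `|u - v|.
pose S := [set x | [/\ vle (g x) x, `|x - v| <= r & vle x u]].
have Su : S u by split=> // j; exact: lexx.
have lb j x : S x -> v 0 j - r <= x 0 j.
  move=> [_ xr _]; rewrite lerBlDr -lerBlDl.
  have := coord_norm_le (x - v) j; rewrite !mxE distrC => /(le_trans (ler_norm _)).
  by move=> /le_trans; apply.
pose w : 'rV[R]_d := \row_j inf [set x 0 j | x in S].
have wS x : S x -> vle w x.
  move=> Sx j; rewrite mxE; apply: ge_inf; last by exists x.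
  by exists (v 0 j - r) => _ [y Sy <-]; exact: lb.
have Sw y : (forall x, S x -> vle y x) -> vle y w.
  move=> yS j; rewrite mxE; apply: lb_le_inf; first by exists (u 0 j), u.
  by move=> _ [x Sx <-]; exact: yS.
have wu := wS u Su.
have gw : vle (g w) w.
  by apply: Sw => x Sx; apply: vle_trans (mono _ _ (wS x Sx)) _; case: Sx.
have wr : `|w - v| <= r.
  apply: row_norm_le => [|j]; first exact: normr_ge0.
  rewrite !mxE ler_norml lerBrDl [X in _ && X]lerBlDl.
  apply/andP; split.
    apply: lb_le_inf; first by exists (u 0 j), u.
    by move=> _ [x Sx <-]; exact: lb.
  have := wu j; rewrite mxE => /le_trans; apply; rewrite -lerBlDl.
  by have := coord_norm_le (u - v) j; rewrite !mxE; exact/le_trans/ler_norm.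
(* It remains to see that [g w] lies in [S], which gives [w <= g w]. *)
exists w; split=> //; apply: vle_anti => //; apply: wS; split.
- exact: mono.
- by rewrite -[v in X in X <= _]gv; apply: le_trans wr; exact: ne.
- exact: vle_trans wu.
Qed.

End Rows.

Lemma finite_sup_affine_order_preserving {R : realType} {d : nat}
  (p : 'rV[R]_d -> R) : finite_sup_affine p -> order_preserving_scalar p.
Proof.
move=> [P [finP P0 PP pE]] x y xy.
have [[q Pq]] := sup_is_min_of_opp finP P0 pE x.
have [_ /(_ q Pq)] := sup_is_min_of_opp finP P0 pE y.
rewrite !fctE /= lerN2 => qy /eqP; rewrite eqr_opp => /eqP-> _.
by apply: le_trans qy; have [_ + _] := PP q Pq; exact.
Qed.

Lemma continuous_displacement {R : realType} {V : normedModType R}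
  (g : V -> V) : nonexpansive g -> continuous (fun x => `|g x - x|).
Proof.
move=> neg x; apply: cvg_norm; apply: cvgB; last exact: cvg_id.
exact: nonexpansive_continuous.
Qed.

(** * Spectral radius of a nonexpansive homogeneous map *)

Section SpectralRadius.
Context {R : realType} {d : nat}.
Variable g : 'rV[R]_d -> 'rV[R]_d.
Hypothesis g_ne : nonexpansive g.
Hypothesis g_hom : forall (a : R) h, 0 < a -> g (a *: h) = a *: g h.

Let eigenvalues := [set a : R | 0 <= a /\
  exists x : 'rV[R]_d, [/\ vle x 0, x <> 0 & g x = a *: x]].

Let g0 : g 0 = 0.
Proof.
(* Homogeneity covers only positive scalars, so the scalar 2 is used: [g 0] is its own double. *)
have := g_hom 0 (ltr0n R 2); rewrite scaler0 => /eqP.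
by rewrite scaler_nat mulr2n -subr_eq0 opprD addrA subrr sub0r oppr_eq0 => /eqP.
Qed.

Let eigenvalue_le1 a : eigenvalues a -> a <= 1.
Proof.
move=> [a0 [x [_ /eqP x0 gx]]].
have := g_ne x 0; rewrite g0 !subr0 gx normrZ ger0_norm//.
by rewrite ger_pMl// normr_gt0.
Qed.

Lemma spectral_radius_le1 : spectral_radius g <= 1.
Proof.
have [E0|/nonemptyPn E0] := pselect (eigenvalues !=set0).
  exact: ge_sup.
(* Without eigenvalues, the supremum takes its default value 0. *)
by rewrite /spectral_radius [X in sup X]E0 sup0.
Qed.

Let cone_sphere := [set x : 'rV[R]_d | vle x 0 /\ `|x| = 1].

Let eigenvector_on_sphere a : eigenvalues a ->
  exists2 x, cone_sphere x & g x = a *: x.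
Proof.
move=> [_ [x [xle /eqP x0 gx]]]; have nx : 0 < `|x| by rewrite normr_gt0.
exists (`|x|^-1 *: x); last first.
  by rewrite g_hom ?invr_gt0// gx !scalerA mulrC.
split=> [j|]; last by rewrite normrZ gtr0_norm ?invr_gt0// mulVf ?gt_eqF.
by have := xle j; rewrite !mxE => xj; rewrite pmulr_rle0 ?invr_gt0.
Qed.

Let cone_sphere_compact : compact cone_sphere.
Proof.
apply: bounded_closed_compact.
  exists 1; split=> // r r1 x [_ /= ->]; exact: ltW.
have -> : cone_sphere = \bigcap_(j in [set: 'I_d])
    ((fun x : 'rV[R]_d => x 0 j) @^-1` [set y | y <= 0])
    `&` (Num.norm : 'rV[R]_d -> R) @^-1` [set 1].
  apply/seteqP; split => x [xle x1]; split=> //.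
    by move=> j _ /=; have := xle j; rewrite mxE.
  by move=> j; have := xle j I; rewrite mxE.
apply: closedI.
  apply: closed_bigI => j _; apply: closed_comp; last exact: closed_le.
  by move=> x _; exact: coord_continuous.
apply: closed_comp; last exact: closed_eq.
by move=> x _; exact: norm_continuous.
Qed.

(* The supremum is attained: [`|g x - x|] has a minimum on the compact set of
   unit vectors of the cone, and it is 0 since eigenvalues accumulate at 1. *)
Lemma spectral_radius1_fixed_vector : spectral_radius g = 1 ->
  exists h, [/\ vle h 0, h <> 0 & g h = h].
Proof.
move=> rho1.
have E0 : eigenvalues !=set0.
  apply/set0P/negP => /eqP E0; move: rho1.
  by rewrite /spectral_radius [X in sup X]E0 sup0 => /eqP; rewrite eq_sym oner_eq0.
have hasE : has_sup eigenvalues by split=> //; exists 1.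
have K0 : cone_sphere !=set0.
  by have [a /eigenvector_on_sphere[x Kx _]] := E0; exists x.
have gap_cont : continuous (fun x => `|g x - x|).
  exact: continuous_displacement.
have [c] := EVT_min_rV K0 cone_sphere_compact (continuous_subspaceT gap_cont).
rewrite inE => -[cle c1] cmin.
suff gc : g c = c by exists c; split=> // c0; move: c1; rewrite c0 normr0 => /eqP;
  rewrite eq_sym oner_eq0.
apply/eqP; rewrite -subr_eq0 -normr_le0; apply/ler_addgt0Pr => e e0.
rewrite add0r.
(* An eigenvalue [a > 1 - e] with unit eigenvector [x] has displacement [1 - a < e]. *)
have [a Ea] := sup_adherent e0 hasE.
rewrite [sup _]rho1 => ae.
have [x Kx gx] := eigenvector_on_sphere Ea.
apply: (@le_trans _ _ `|g x - x|); first by apply: cmin; rewrite inE.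
rewrite gx -[X in _ - X]scale1r -scalerBl normrZ.
rewrite (proj2 Kx) mulr1 distrC ger0_norm ?subr_ge0 ?eigenvalue_le1//; lra.
Qed.

End SpectralRadius.

(** * Finiteness of the set of strategies *)

Lemma strategy_pigeonhole {T : Type} {d : nat} (A : 'I_d -> set T)
    (pi : nat -> 'I_d -> T) :
  (forall j, finite_set (A j)) -> (forall k, strategy A (pi k)) ->
  exists i j : nat, (i < j)%N /\ pi i = pi j.
Proof.
(* A choice structure on [T] makes membership and [index] in sequences available. *)
elim/Pchoice: T => T in A pi * => finA sA.
have [s sP] := choice (fun j => iffLR (finite_seqP (A j)) (finA j)).
have mem k j : pi k j \in s j by have := sA k j; rewrite sP.
pose N := (\max_j size (s j))%N.
have idx k j : (index (pi k j) (s j) < N.+1)%N.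
  rewrite ltnS; apply: leq_trans (leq_bigmax j).
  by rewrite ltnW// index_mem.
(* A strategy is encoded by the positions of its actions in lists enumerating the sets [A j]. *)
pose code k : {ffun 'I_d -> 'I_N.+1} := [ffun j => Ordinal (idx k j)].
have code_inj i j : code i = code j -> pi i = pi j.
  move=> cij; apply/funext => k; have := congr1 (fun c : {ffun _ -> _} => c k) cij.
  rewrite !ffunE => -[/(congr1 (nth (pi i k) (s k)))].
  by rewrite !nth_index.
pose M := #|{ffun 'I_d -> 'I_N.+1}|.
have /fintype.injectivePn[i [j ij cij]] :
    ~~ injectiveb (fun k : 'I_M.+1 => code k).
  by apply/negP => /injectiveP/leq_card; rewrite card_ord ltnn.
wlog lij : i j ij cij / (i < j)%N => [H|].
  have [lij|lji|e] := ltngtP i j; first exact: H lij.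
    by apply: (H j i) => //; rewrite eq_sym.
  by move: ij; rewrite (val_inj e) eqxx.
by exists i, j; split=> //; exact: code_inj.
Qed.

(** * One step of policy iteration *)

Section PolicyIteration.
Context {R : realType} {d : nat} {T : Type}.
Variables (A : 'I_d -> set T) (fa : T -> 'rV[R]_d -> R).
Variable f : 'rV[R]_d -> 'rV[R]_d.
Hypothesis A_finite : forall j, finite_set (A j).
Hypothesis A_nonempty : forall j, A j !=set0.
Hypothesis fa_sup : forall j a, A j a -> finite_sup_affine (fa a).
Hypothesis f_inf : forall x j, f x 0 j = inf [set fa a x | a in A j].
Hypothesis f_nonexpansive : nonexpansive f.
Implicit Types (u h : 'rV[R]_d) (pi : 'I_d -> T).

Let f_min j : is_min_of (A j) fa (fun x => f x 0 j).
Proof. by apply: inf_is_min_of => // x; exact: f_inf. Qed.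

Let fa_nonexpansive j a : A j a -> nonexpansive (fa a).
Proof. by move=> /fa_sup; exact: finite_sup_affine_nonexpansive. Qed.

Let fa_locally j a u : A j a ->
  locally_equal_to (fa a) u (semidifferential (fa a) u).
Proof.
move=> Aa; apply: semidifferentialP; first exact: fa_nonexpansive Aa.
exact: finite_sup_affine_conical (fa_sup Aa).
Qed.

Let f_locally u : locally_equal_to f u (semidifferential f u).
Proof.
apply: semidifferentialP => //; apply: conical_at_coord => j.
apply: (conical_at_min (A_finite j) (f_min j)) => a Aa.
  exact: fa_nonexpansive Aa.
exact: finite_sup_affine_conical (fa_sup Aa).
Qed.

Lemma strategy_map_order_preserving pi :
  strategy A pi -> order_preserving (strategy_map fa pi).
Proof.
move=> sA x y xy j; rewrite !mxE.
exact: (finite_sup_affine_order_preserving (fa_sup (sA j))).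
Qed.

Lemma strategy_map_nonexpansive pi :
  strategy A pi -> nonexpansive (strategy_map fa pi).
Proof.
move=> sA x y; apply: row_norm_le => // j; rewrite !mxE.
exact: (fa_nonexpansive (sA j)).
Qed.

Lemma strategy_map_ge pi u : strategy A pi -> vle (f u) (strategy_map fa pi u).
Proof. by move=> sA j; rewrite mxE; case: (f_min j u) => _; exact. Qed.

Lemma improvement_strategy u pi : improvement A fa f u pi -> strategy A pi.
Proof.
by case=> [[]//|[_ _ [h [_ _ _ piP]]] j]; have [[]] := piP j.
Qed.

(* Near [u] the minimum defining [f] is attained at actions active at [u], so
   an action minimizing the semidifferential in the direction [h] attains it on
   a segment issued from [u]. *)
Lemma active_minimizer_on_ray u h j a :
  active_actions A fa f u j a ->
  (forall b, active_actions A fa f u j b ->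
     (semidifferential (fa a) u h : R) <= semidifferential (fa b) u h) ->
  exists2 e : R, 0 < e & forall t, 0 < t -> `|t *: h| < e ->
    fa a (u + t *: h) = f (u + t *: h) 0 j.
Proof.
move=> [Aa au] amin.
have [r r0 rP] := min_active (f_min j) (@fa_nonexpansive j) u (A_finite j).
have [e e0 eP] : exists2 e : R, 0 < e & forall b, A j b -> forall h, `|h| < e ->
    fa b (u + h) = fa b u + semidifferential (fa b) u h.
  apply: finite_common_radius => // [b e e' H _ e'e k ke|b Ab].
    by apply: H; exact: lt_le_trans e'e.
  by have [_] := fa_locally u Ab.
exists (Num.min r e) => [|t t0]; first by rewrite lt_min r0.
rewrite lt_min => /andP[thr the].
have [[b Ab fb] fle] := f_min j (u + t *: h).
have bu := rP b _ Ab thr fb.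
apply/eqP; rewrite eq_le fle// andbT fb !eP// au bu lerD2l.
have [homa _] := fa_locally u Aa; have [homb _] := fa_locally u Ab.
by rewrite homa// homb// /GRing.scale /= ler_pM2l//; exact: amin.
Qed.

Lemma improvement_decreases u pi v :
  improvement A fa f u pi -> smallest_fixed_point (strategy_map fa pi) v ->
  vlt v u.
Proof.
move=> imp [vfix vmin]; have sA := improvement_strategy imp.
case: imp => [[[fu nfu] _ fpi]|[fu _ [h [h0 nh gh piP]]]].
  have [||||w [wfix wu]] := @fixed_point_below _ _ (strategy_map fa pi) u v.
  - exact: strategy_map_order_preserving.
  - exact: strategy_map_nonexpansive.
  - by [].
  - by rewrite -fpi.
  split; first exact: vle_trans (vmin w wfix) wu.
  by move=> vu; apply: nfu; rewrite fpi -vu.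
have [e e0 eP] : exists2 e : R, 0 < e & forall j, [set: 'I_d] j ->
    forall t, 0 < t -> `|t *: h| < e ->
    fa (pi j) (u + t *: h) = f (u + t *: h) 0 j.
  apply: finite_common_radius => [|j e e' H _ e'e t t0 the|j _].
  - exact: finite_finset.
  - by apply: H => //; exact: lt_le_trans e'e.
  - by apply: active_minimizer_on_ray; case: (piP j).
have [homf [r r0 rP]] := f_locally u.
have er0 : 0 < Num.min e r by rewrite lt_min e0.
have [t [t0 _]] := small_scaling h er0; rewrite lt_min => /andP[the thr].
(* On this segment the new strategy map agrees with [f], whose expansion at [u] is exact and fixes
   the direction [h]. *)
have tfix : strategy_map fa pi (u + t *: h) = u + t *: h.
  apply/rowP => j; rewrite mxE eP//.
  by rewrite rP// homf// gh fu.
have ulow : vle (u + t *: h) u.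
  move=> j; rewrite !mxE gerDl pmulr_rle0//.
  by have := h0 j; rewrite mxE.
split; first exact: vle_trans (vmin _ tfix) ulow.
(* If [v = u], minimality gives [u <= u + t *: h], hence [0 <= h], and [h] would be zero. *)
move=> vu; apply: nh; apply: vle_anti => // j.
have := vmin _ tfix j; rewrite vu !mxE lerDl pmulr_rge0//.
Qed.

(** The tests are exhaustive: [f u] lies below the image of [u] under the strategy map, which is
    [u], and the spectral radius is at most 1. *)
Lemma continuation u pi :
  strategy A pi -> smallest_fixed_point (strategy_map fa pi) u ->
  stops f u \/ exists pi', improvement A fa f u pi'.
Proof.
move=> sA [ufix _].
have [fu|nfu] := pselect (f u = u); last first.
  right; have [pi' piP] := choice (fun j => iffLR (exists2P _ _) (f_min j u).1).
  exists pi'; left; split.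
  - by split=> //; rewrite -[X in vle _ X]ufix; exact: strategy_map_ge.
  - by move=> j; case: (piP j).
  - by apply/rowP => j; rewrite mxE; case: (piP j).
have [homf _] := f_locally u.
have gne := locally_equal_nonexpansive f_nonexpansive (f_locally u).
have := spectral_radius_le1 gne homf.
rewrite le_eqVlt => /predU1P[rho1|]; last by left.
right; have [h [h0 nh gh]] := spectral_radius1_fixed_vector gne homf rho1.
have greedy j : exists p, active_actions A fa f u j p /\
    forall a, active_actions A fa f u j a ->
      (semidifferential (fa p) u h : R) <= semidifferential (fa a) u h.
  have fin : finite_set (active_actions A fa f u j).
    by apply: sub_finite_set (A_finite j) => a [].
  have ex : active_actions A fa f u j !=set0.
    by have [[a Aa fua] _] := f_min j u; exists a.
  by have [p] := finite_argmin fin ex (fun a => semidifferential (fa a) u h);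
    exists p.
have [pi' piP] := choice greedy.
by exists pi'; right; split=> //; exists h; split.
Qed.

End PolicyIteration.

(** * Termination *)

Theorem theorem4p1 (R : realType) (d : nat) (T : Type)
    (A : 'I_d -> set T) (fa : T -> 'rV[R]_d -> R)
    (f : 'rV[R]_d -> 'rV[R]_d)
    (A_finite : forall j, finite_set (A j))
    (A_nonempty : forall j, A j !=set0)
    (fa_sup : forall j a, A j a -> finite_sup_affine (fa a))
    (f_inf : forall x j, f x 0 j = inf [set fa a x | a in A j])
    (f_order_preserving : order_preserving f)
    (f_nonexpansive : nonexpansive f)
    (smallest_fp : forall pi, strategy A pi ->
       exists u, smallest_fixed_point (strategy_map fa pi) u) :
  policy_iteration_terminates A fa f.
Proof.
have strat n pi u : run_upto A fa f n pi u -> strategy A (pi n).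
  by case: n => [|n] [s0 _ imp] //; exact: improvement_strategy (imp n (ltnSn n)).
split=> [pi u run|n pi u run]; last first.
  have [_ + _] := run; move=> /(_ n (leqnn n)).
  exact/continuation/strat/run.
have [i [j [ij piij]]] := strategy_pigeonhole A_finite
  (fun k => strat k pi u (run k)).
have fp k : smallest_fixed_point (strategy_map fa (pi k)) (u k).
  by have [_ /(_ k (leqnn k))] := run k.
have step k : vlt (u k.+1) (u k).
  have [_ _ /(_ k (ltnSn k)) imp] := run k.+1.
  exact: improvement_decreases imp (fp k.+1).
have decr k : vlt (u (k.+1 + i)%N) (u i).
  by elim: k => [|k IH]; [exact: step|exact: vlt_trans (step _) IH].
(* As [i < j], this index turns [decr] into [vlt (u j) (u i)]; equal strategies, however, have equal
   smallest fixed points. *)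
have [_] := decr (j - i.+1)%N; rewrite addSnnS subnK//; apply.
have [[fi mini] [fj minj]] := (fp i, fp j).
by apply: vle_anti; [apply: minj; rewrite -piij|apply: mini; rewrite piij].
Qed.
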